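(* Let $(\mathcal{X},\mathcal{B},\mu)$ be a probability space and let $x\mapsto Q_x$ be a map from $\mathcal{X}$ to positive measures on $\mathcal{X}$ such that $x\mapsto Q_x(A)$ is measurable for each $A\in\mathcal{B}$ and the detailed balance condition $Q_x(dy)\mu(dx)=Q_y(dx)\mu(dy)$ holds. Let $$\Gamma_+(f)(x)=\int_{\mathcal{X}}(f(x)-f(y))_+^2\,Q_x(dy),\qquad \mathcal{E}(f,g)=\frac12\int_{\mathcal{X}}\int_{\mathcal{X}}(f(y)-f(x))(g(y)-g(x))\,Q_x(dy)\mu(dx),$$ where $\mathcal{E}$ is considered on $\mathrm{Dom}(\mathcal{E})=\{f \text{ measurable}\colon \int\int (f(y)-f(x))^2Q_x(dy)\mu(dx)<\infty\}$. Assume that for all $p\in(1,2]$ the Beckner inequality $$\alpha_p\bigl(\mu(f^p)-\mu(f)^p\bigr)\le \frac p2\,\mathcal{E}(f,f^{p-1})\quad\text{for all nonnegative } f\in\mathrm{Dom}(\mathcal{E}) \text{ with } f^{p-1}\in\mathrm{Dom}(\mathcal{E})$$ is satisfied with constant $\alpha_p\ge a(p-1)^s$ for some $a>0$, $s\ge0$. Then for every measurable $f\colon\mathcal{X}\to\mathbb{R}$ and every $r\ge2$, $$\|(f-\mu(f))_+\|_r^2\le (1-2^{-(s+1)})\frac{r^{s+1}}{a}\kappa(s)\,\|\Gamma_+(f)\|_{r/2},$$ $$\|(\mu(f)-f)_+\|_r^2\le (1-2^{-(s+1)})\frac{r^{s+1}}{a}\kappa(s)\,\|\Gamma_+(-f)\|_{r/2},$$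 where $\kappa(s)=(1-e^{-(s+1)/2})^{-1}$.
   Context: Notation: $\mu(f)=\int_{\mathcal{X}} f\,d\mu$, $\|g\|_r=(\mu(|g|^r))^{1/r}$, $t_+=\max(t,0)$. Convention: an estimate $A\le B$ means ''if the right-hand side is finite, then the left-hand side is well-defined and the inequality holds''. *)

(* Defs.v *)
From HB Require Import structures.
From mathcomp Require Import all_boot all_order all_algebra.
From mathcomp Require Import all_classical all_reals all_analysis.
From mathcomp Require Import measurable_realfun.

Set Implicit Arguments.
Unset Strict Implicit.
Unset Printing Implicit Defensive.
Import Order.TTheory GRing.Theory Num.Theory.
Import numFieldNormedType.Exports.

Local Open Scope classical_set_scope.
Local Open Scope ring_scope.
Local Open Scope ereal_scope.

(* An estimate A <= B in the sense "if the right-hand side is finite, then the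
   left-hand side is well-defined and the inequality holds".  The integrals of
   the library are total, so the well-definedness [wd] of A is a separate
   proposition. *)
Definition estimate (R : realType) (wd : Prop) (A B : \bar R) : Prop :=
  B \is a fin_num -> wd /\ A <= B.

Section jump_kernel.
Context (d : measure_display) (X : measurableType d) (R : realType).
Variables (mu : probability X R) (Q : R.-ker X ~> X).
Implicit Types f g : X -> R.

(* The equality Q_x(dy) mu(dx) = Q_y(dx) mu(dy) of measures on X * X.
   The kernel Q is not assumed to be finite, nor even s-finite, so that
   Q_x(dy) mu(dx) is a well-defined measure on X * X, with value
   \int Q_x(C_x) mu(dx) on C, only if x |-> Q_x(C_x) is measurable; this is
   the first clause, which is automatic for s-finite kernels. *)
Definition detailed_balance : Prop :=
  (forall C : set (X * X), measurable C ->
     measurable_fun [set: X] (fun x => Q x (xsection C x))) /\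
  (forall C : set (X * X), measurable C ->
     \int[mu]_x Q x (xsection C x) = \int[mu]_y Q y (ysection C y)).

Definition Gamma_plus f (x : X) : \bar R :=
  \int[Q x]_y ((Num.max (f x - f y) 0) ^+ 2)%R%:E.

Definition dirichlet_form f g : \bar R :=
  (2^-1)%:E * \int[mu]_x \int[Q x]_y ((f y - f x) * (g y - g x))%R%:E.

Definition dirichlet_dom f : Prop :=
  measurable_fun [set: X] f /\
  \int[mu]_x \int[Q x]_y ((f y - f x) ^+ 2)%R%:E < +oo.

Definition beckner (p alpha : R) : Prop :=
  forall f, (forall x, 0 <= f x)%R ->
    dirichlet_dom f -> dirichlet_dom (fun x => f x `^ (p - 1))%R ->
    estimate
      (mu.-integrable [set: X] (EFin \o f) /\
       mu.-integrable [set: X] (EFin \o (fun x => f x `^ p)%R))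
      (alpha * (\int[mu]_x (f x `^ p) - (\int[mu]_x f x) `^ p))%R%:E
      ((p / 2)%R%:E * dirichlet_form f (fun x => f x `^ (p - 1))%R).

End jump_kernel.

Definition kappa (R : realType) (s : R) : R := (1 - expR (- ((s + 1) / 2)))^-1.

(* Main.v *)
(* Put g = (f - mu f)_+, clipped at a level n so that all quantities are finite,
   and k = || Gamma_+(f) ||_{r/2}.  Beckner's inequality with p = q / (q - 1)
   applied to g^(q - 1) bounds || g ||_q^q by || g ||_{q-1}^q plus a multiple of
   the integral of g^(q - 2) Gamma_+(f), because by detailed balance the energy
   can be computed on the pairs with g x > g y, where convexity gives
     (g x^(q-1) - g y^(q-1)) (g x - g y) <= (q - 1) g x^(q-2) (f x - f y)_+^2.
   By Hoelder's inequality that integral is at most k || g ||_q^(q-2).  The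
   resulting recursion in q is started on [1, 2] by the case p = 2, which bounds
   the variance, and (1 - 1/q)^((s+1) q/2) <= exp (- (s+1)/2) = 1 - 1/kappa
   makes the bound reproduce itself.  Finally n tends to infinity.  The second
   estimate is the first one for - f. *)
Require Import Defs.
From HB Require Import structures.
From mathcomp Require Import all_boot all_order all_algebra.
From mathcomp Require Import all_classical all_reals all_analysis.
From mathcomp Require Import measurable_realfun.
From mathcomp Require Import ring lra.

Set Implicit Arguments.
Unset Strict Implicit.
Unset Printing Implicit Defensive.
Import Order.TTheory GRing.Theory Num.Theory.
Import numFieldNormedType.Exports.

Local Open Scope classical_set_scope.
Local Open Scope ring_scope.
Local Open Scope ereal_scope.

(** * Inequalities between real numbers *)

Section real_inequalities.
Context (R : realType).
Implicit Types a b q s t x y z : R.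
Local Open Scope ring_scope.

Lemma sqr_max_sqr_maxN x : Num.max x 0 ^+ 2 + Num.max (- x) 0 ^+ 2 = x ^+ 2.
Proof.
have [x0|/ltW x0] := leP x 0.
  by have /max_l-> : 0 <= - x; rewrite ?oppr_ge0// expr0n add0r sqrrN.
by have /max_r-> : - x <= 0; rewrite ?oppr_le0// expr0n addr0.
Qed.

(** The quotient is the product of [x / (x + 1)], at most 1, and [e / (1 + e)], at most both 1 and
    [e]. It justifies the translation level chosen in [beckner_variance]. *)
Lemma sqr_div_le x e : 0 <= x -> 0 < e ->
  (x / ((x + 1) * (1 + e^-1))) ^+ 2 <= e.
Proof.
move=> x0 e0.
have -> : x / ((x + 1) * (1 + e^-1)) = x / (x + 1) * (e / (1 + e)).
  by field; rewrite !gt_eqF//; lra.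
have x1 : x / (x + 1) <= 1 by rewrite ler_pdivrMr; lra.
have e1 : e / (1 + e) <= 1 by rewrite ler_pdivrMr; lra.
have e2 : e / (1 + e) <= e by rewrite ler_pdivrMr; nra.
have e3 : 0 <= e / (1 + e) by rewrite divr_ge0; lra.
have x3 : 0 <= x / (x + 1) by rewrite divr_ge0; lra.
have p0 := mulr_ge0 x3 e3; rewrite expr2 -[leRHS]mul1r; apply: ler_pM => //.
  exact: mulr_ile1.
by rewrite (le_trans _ e2)// ler_piMl.
Qed.

Lemma max0_lipschitz x y : `|Num.max x 0 - Num.max y 0| <= `|x - y|.
Proof.
wlog yx : x y / y <= x => [H|].
  by have [/H//|/ltW/H] := leP y x; rewrite distrC (distrC y).
have : Num.max y 0 <= Num.max x 0 by rewrite le_max2.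
rewrite -subr_ge0 => /ger0_norm->; rewrite ger0_norm ?subr_ge0//.
by have [] := leP x 0; have [] := leP y 0; lra.
Qed.

Lemma powR_sub_le a b t : 0 <= b <= a -> 1 <= t ->
  a `^ t - b `^ t <= t * a `^ (t - 1) * (a - b).
Proof.
move=> /andP[b0 ba]; rewrite le_eqVlt => /predU1P[<-|t1].
  by rewrite subrr powRr0 !powRr1 ?(le_trans b0)// !mul1r.
have t0 : 0 < t by rewrite (lt_trans _ t1).
move: (le_trans b0 ba); rewrite le_eqVlt => /predU1P[a0|a0].
  have -> : b = a by apply/eqP; rewrite eq_le ba -a0 b0.
  by rewrite !subrr mulr0.
pose c := b / a; have c0 : 0 <= c by rewrite divr_ge0// ltW.
have bE : b = a * c by rewrite /c mulrCA divff ?mulr1// gt_eqF.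
have t1t : 0 < t / (t - 1) by rewrite divr_gt0// subr_gt0.
have := @conjugate_powR _ c 1 t (t / (t - 1)) c0 ler01 t0 t1t.
have -> : t^-1 + (t / (t - 1))^-1 = 1.
  by rewrite invf_div -[X in X + _]div1r -mulrDl subrKC divff// gt_eqF.
move=> /(_ erefl); rewrite mulr1 powR1 invf_div !mul1r.
rewrite -mulrDl ler_pdivlMr// => ct.
rewrite bE powRM ?(ltW a0)//.
rewrite -[a `^ t](mulr_powRB1 (ltW a0) t0).
have -> : a * a `^ (t - 1) - a * a `^ (t - 1) * c `^ t =
  a * a `^ (t - 1) * (1 - c `^ t) by ring.
have -> : t * a `^ (t - 1) * (a - a * c) =
  a * a `^ (t - 1) * (t * (1 - c)) by ring.
rewrite ler_wpM2l ?mulr_ge0 ?powR_ge0 ?(ltW a0)//.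
lra.
Qed.

(* One step of the recursion on moments: [y] stands for the [q]-th power of an
   [L^q] norm that is to be compared with [t `^ (q / 2)]. *)
Lemma le_powR_of_le_convex a b q t y : 2 <= q -> 0 <= t -> 0 <= y ->
  0 <= a -> 0 <= b -> a + b <= 1 ->
  y <= a * t `^ (q / 2) + b * t * y `^ ((q - 2) / q) -> y <= t `^ (q / 2).
Proof.
move=> q2 t0 y0 a0 b0 ab hy.
have q0 : 0 < q by rewrite (lt_le_trans _ q2).
rewrite leNgt; apply/negP => ty.
have y_gt0 : 0 < y by rewrite (le_lt_trans _ ty)// powR_ge0.
pose u := y `^ (2 / q); have u0 : 0 < u by rewrite powR_gt0.
have uq : y = u `^ (q / 2).
  rewrite /u -powRrM (_ : 2 / q * (q / 2) = 1) ?powRr1//.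
  by field; rewrite gt_eqF.
have tu : t < u.
  rewrite ltNge; apply/negP => ut; move: ty; rewrite ltNge => /negP; apply.
  by rewrite {1}uq ge0_ler_powR ?nnegrE ?divr_ge0 ?(ltW u0)// ltW.
have yq : y `^ ((q - 2) / q) = u `^ (q / 2 - 1).
  rewrite {1}uq -powRrM; congr (_ `^ _); field.
  by rewrite gt_eqF.
have split_q v : 0 <= v -> v `^ (q / 2) = v * v `^ (q / 2 - 1).
  by move=> v0; rewrite mulr_powRB1// divr_gt0.
have tu' : t `^ (q / 2 - 1) <= u `^ (q / 2 - 1).
  rewrite ge0_ler_powR ?nnegrE ?(ltW u0) ?(ltW tu)//.
  by rewrite subr_ge0 ler_pdivlMr// mul1r.
have w0 : 0 < u `^ (q / 2 - 1) by rewrite powR_gt0.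
suff : y <= t * u `^ (q / 2 - 1).
  by rewrite {1}uq split_q ?(ltW u0)// ler_pM2r// leNgt tu.
apply: (le_trans hy); rewrite yq split_q//.
apply: (@le_trans _ _ ((a + b) * (t * u `^ (q / 2 - 1)))).
  rewrite mulrDl -[b * t * _]mulrA lerD2r.
  by rewrite ler_wpM2l// ler_wpM2l.
by rewrite -[leRHS]mul1r ler_wpM2r// mulr_ge0// ltW.
Qed.

(** Since [ln (1 - 1 / q) <= - 1 / q], the factor [q] of the exponent cancels. At [q = 1] the base
    is 0 and the power vanishes. *)
Lemma powR_ratio_le_expR s q : 0 <= s -> 1 <= q ->
  ((q - 1) / q) `^ ((s + 1) * (q / 2)) <= expR (- ((s + 1) / 2)).
Proof.
move=> s0 q1; have q0 : 0 < q by rewrite (lt_le_trans _ q1).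
have [->|q_neq1] := eqVneq q 1.
  rewrite subrr mul0r powR0 ?expR_ge0// gt_eqF// mulr_gt0//; lra.
have q1' : 0 < q - 1 by rewrite subr_gt0 lt_neqAle eq_sym q_neq1.
have r0 : 0 < (q - 1) / q by rewrite divr_gt0.
rewrite /powR (gt_eqF r0) ler_expR.
have lnr : ln ((q - 1) / q) <= - q^-1.
  have -> : (q - 1) / q = 1 + - q^-1 by field; rewrite gt_eqF.
  apply: le_ln1Dx; rewrite ltrN2 invf_lt1//; lra.
have c0 : 0 <= (s + 1) * (q / 2) by rewrite mulr_ge0//; lra.
apply: (le_trans (ler_wpM2l c0 lnr)).
rewrite le_eqVlt; apply/orP; left; apply/eqP; field.
by rewrite gt_eqF.
Qed.

Lemma powR2N_le_expR x : 0 <= x -> (2 : R) `^ (- x) <= expR (- (x / 2)).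
Proof.
move=> x0; rewrite powRN /powR gt_eqF// -expRN ler_expR lerN2.
rewrite mulrC [leRHS]mulrC ler_wpM2r// -[2^-1]opprK lerNl -lnV ?posrE//.
have : ln (1 + - 2^-1) <= - 2^-1 :> R.
  by apply: le_ln1Dx; rewrite ltrN2 invf_lt1// ltr1n.
by rewrite (_ : 1 + - 2^-1 = 2^-1 :> R)//; field.
Qed.

Lemma deviation_constant_gt0 a s q : 0 < a -> 0 <= s -> 0 < q ->
  0 < (1 - 2 `^ (- (s + 1))) * (q `^ (s + 1) / a) * kappa s.
Proof.
move=> a0 s0 q0; have s10 : 0 < s + 1 by rewrite ltr_wpDl.
have A1 : expR (- ((s + 1) / 2)) < 1 by rewrite expR_lt1 oppr_lt0 divr_gt0.
rewrite !mulr_gt0 ?invr_gt0 ?powR_gt0 ?subr_gt0//.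
exact: le_lt_trans (powR2N_le_expR (ltW s10)) A1.
Qed.

(** Here [M q] plays the role of the integral of [g]^ q[. Each step lowers the order by one until it
    lies in [1, 2], and the bound]T q [^ (q / 2)] is reproduced with the weights [A] and [1 - A]. *)
Lemma moment_recursion (M : R -> R) a s k r : 0 < a -> 0 <= s -> 0 <= k ->
  (forall q, 0 <= M q) ->
  (forall q, 1 <= q <= 2 -> M q <= (k / a) `^ (q / 2)) ->
  (forall q, 2 <= q <= r ->
    M q <= M (q - 1) `^ (q / (q - 1)) +
           q / 2 * ((q - 1) `^ s / a) * k * M q `^ ((q - 2) / q)) ->
  forall q, 1 <= q <= r ->
    M q <=
    ((1 - 2 `^ (- (s + 1))) * (q `^ (s + 1) / a) * kappa s * k) `^ (q / 2).
Proof.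
move=> a0 s0 k0 M0 base step.
pose A : R := expR (- ((s + 1) / 2)).
pose c : R := 1 - 2 `^ (- (s + 1)).
have A0 : 0 < A by exact: expR_gt0.
have A1 : A < 1 by rewrite expR_lt1 oppr_lt0 divr_gt0// ltr_wpDl.
have B0 : 0 < 1 - A by rewrite subr_gt0.
have cA : 1 - A <= c.
  by rewrite lerB// powR2N_le_expR// addr_ge0.
(* This absorbs the 1/2 in the factor [q / 2] of the recursion. *)
have c2 : 2^-1 <= c.
  have : (2 : R) `^ (- (s + 1)) <= 2 `^ (-1).
    by rewrite ler_powR ?ler1n// lerN2 lerDr.
  rewrite powR_inv1// /c; lra.
have c0 : 0 < c by rewrite (lt_le_trans B0).
pose T q : R := c * (q `^ (s + 1) / a) * (1 - A)^-1 * k.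
have T0 q : 0 <= T q.
  by rewrite !mulr_ge0 ?invr_ge0 ?powR_ge0// ltW.
(* The order [q] is real, so the induction runs over a natural number bounding [q - 2]. *)
suff H : forall (m : nat) q, 1 <= q <= r -> q <= m%:R + 2 ->
    M q <= T q `^ (q / 2).
  move=> q /[dup] /andP[q1 _] qr; apply: (H (Num.bound q)) => //.
  rewrite (le_trans (ltW (archi_boundP _)))//; first by rewrite (le_trans _ q1).
  by rewrite lerDl.
have small q : 1 <= q <= 2 -> M q <= T q `^ (q / 2).
  move=> /[dup] q12 /andP[q1 _]; apply: (le_trans (base _ q12)).
  rewrite ge0_ler_powR ?nnegrE//.
  - by rewrite divr_ge0// (le_trans _ q1).
  - by rewrite divr_ge0// ltW.
  have -> : T q = (c / (1 - A) * q `^ (s + 1)) * (k / a).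
    by rewrite /T; field; rewrite !gt_eqF.
  rewrite ler_peMl//; first by rewrite divr_ge0// ltW.
  rewrite -[leLHS]mulr1 ler_pM//; first by rewrite ler_pdivlMr// mul1r.
  by have := ler_powR q1 (addr_ge0 s0 ler01); rewrite powRr0.
elim=> [|m IH] q /andP[q1 qr] qm.
  by apply: small; rewrite q1/= (le_trans qm)// add0r.
have [q2|q2] := leP q 2; first by apply: small; rewrite q1.
have q0 : 0 < q by rewrite (lt_trans _ q2).
have q10 : 0 < q - 1 by rewrite subr_gt0 (lt_trans _ q2)// ltr1n.
apply: (@le_powR_of_le_convex A (1 - A)) => //;
  [exact: ltW|exact: ltW|exact: ltW|lra|].
have hq : 2 <= q <= r by rewrite (ltW q2).
apply: (le_trans (step q hq)); apply: lerD; last first.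
  rewrite ler_wpM2r ?powR_ge0//.
  have -> : (1 - A) * T q = (c * q `^ (s + 1)) * (k / a).
    by rewrite /T; field; rewrite !gt_eqF.
  have -> : q / 2 * ((q - 1) `^ s / a) * k =
      (2^-1 * (q * (q - 1) `^ s)) * (k / a).
    by field; rewrite gt_eqF.
  rewrite ler_wpM2r ?divr_ge0 ?(ltW a0)// ler_pM//.
    by rewrite mulr_ge0 ?powR_ge0 ?(ltW q0).
  have -> : q `^ (s + 1) = q * q `^ s.
    by rewrite addrC powRD ?powRr1 ?(ltW q0)// (gt_eqF q0) implybT.
  rewrite ler_wpM2l ?(ltW q0)// ge0_ler_powR ?nnegrE ?(ltW q0) ?(ltW q10)//.
  by rewrite gerBl.
have IHq : M (q - 1) <= T (q - 1) `^ ((q - 1) / 2).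
  by apply: IH; [lra|move: qm; rewrite -natr1; lra].
apply: (@le_trans _ _ ((T (q - 1) `^ ((q - 1) / 2)) `^ (q / (q - 1)))).
  by rewrite ge0_ler_powR ?nnegrE ?powR_ge0// divr_ge0// ltW.
rewrite -powRrM (_ : (q - 1) / 2 * (q / (q - 1)) = q / 2); last first.
  by field; rewrite gt_eqF.
(* Raised to the power [q / 2], the ratio of the two bounds is at most [A], the first weight. *)
have -> : T (q - 1) = ((q - 1) / q) `^ (s + 1) * T q.
  rewrite /T powRM ?invr_ge0 ?(ltW q0) ?(ltW q10)//.
  rewrite -(powR_inv1 (ltW q0)) -powRrM mulN1r powRN.
  by field; rewrite !gt_eqF// powR_gt0.
rewrite powRM ?powR_ge0// ler_wpM2r ?powR_ge0// -powRrM.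
by apply: powR_ratio_le_expR => //; lra.
Qed.

(** The positive part of the deviation from [m], cut off at [n]. Being bounded it has finite
    moments, and being Lipschitz and nondecreasing in [u] it keeps energies under control. *)
Definition clip (m n u : R) : R := Num.min (Num.max (u - m) 0) n.

Lemma clip_ge0 m n u : 0 <= n -> 0 <= clip m n u.
Proof. by move=> n0; rewrite le_min n0 le_max lexx orbT. Qed.

Lemma clip_le m n u : clip m n u <= n.
Proof. by rewrite ge_min lexx orbT. Qed.

Lemma clip_homo m n u v : u <= v -> clip m n u <= clip m n v.
Proof. by move=> uv; rewrite le_min2// le_max2// lerD2r. Qed.

Lemma clipB_le m n u v : u <= v -> clip m n v - clip m n u <= v - u.
Proof.
move=> uv; rewrite /clip.
have [um|um] := leP (u - m) 0; have [vm|vm] := leP (v - m) 0.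
- by rewrite subrr subr_ge0.
- by have [] := leP (v - m) n; have [] := leP 0 n; lra.
- lra.
- by have [] := leP (v - m) n; have [] := leP (u - m) n; lra.
Qed.

Lemma clip_lipschitz m n u v : `|clip m n v - clip m n u| <= `|v - u|.
Proof.
wlog uv : u v / u <= v => [H|].
  by have [/H//|/ltW/H] := leP u v; rewrite distrC (distrC u).
by rewrite !ger0_norm ?subr_ge0 ?clip_homo ?clipB_le.
Qed.

(** The slope of the power is largest at the top value [n]. This puts powers of the clipped function
    in the domain of the Dirichlet form. *)
Lemma clip_powR_lipschitz m n t u v : 0 <= n -> 1 <= t ->
  `|clip m n v `^ t - clip m n u `^ t| <= t * n `^ (t - 1) * `|v - u|.
Proof.
move=> n0 t1; wlog uv : u v / u <= v => [H|].
  by have [/H//|/ltW/H] := leP u v; rewrite distrC (distrC u).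
have cu : 0 <= clip m n u <= clip m n v by rewrite clip_ge0// clip_homo.
have t0 : 0 <= t by rewrite (le_trans _ t1).
rewrite !ger0_norm ?subr_ge0//; last first.
  by rewrite ge0_ler_powR ?nnegrE ?clip_ge0// clip_homo.
apply: (le_trans (powR_sub_le cu t1)).
rewrite ler_pM ?clipB_le ?mulr_ge0 ?powR_ge0 ?subr_ge0 ?clip_homo//.
by rewrite ler_wpM2l// ge0_ler_powR ?nnegrE ?clip_ge0 ?clip_le// subr_ge0.
Qed.

(** Only one of the two positive parts can be nonzero. The symmetric form makes the bound a sum of a
    function of [(u, v)] and its transpose, as detailed balance requires. *)
Lemma clip_powR_sub_mul_le m n q u v : 0 <= n -> 2 <= q ->
  (clip m n v `^ (q - 1) - clip m n u `^ (q - 1)) * (clip m n v - clip m n u) <=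
    (q - 1) * clip m n u `^ (q - 2) * Num.max (u - v) 0 ^+ 2 +
    (q - 1) * clip m n v `^ (q - 2) * Num.max (v - u) 0 ^+ 2.
Proof.
move=> n0 q2; wlog uv : u v / u <= v => [H|].
  have [/H//|/ltW/H {}H] := leP u v.
  by rewrite [leRHS]addrC (le_trans _ H)// -mulrNN !opprB.
have -> : Num.max (u - v) 0 = 0 by apply/max_r; rewrite subr_le0.
have -> : Num.max (v - u) 0 = v - u by apply/max_l; rewrite subr_ge0.
rewrite expr0n mulr0 add0r expr2 mulrA.
have cu : 0 <= clip m n u <= clip m n v by rewrite clip_ge0// clip_homo.
have q1 : 1 <= q - 1 by lra.
have hq : q - 2 = q - 1 - 1 by lra.
have q10 : 0 <= (q - 1) * clip m n v `^ (q - 2).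
  by rewrite mulr_ge0 ?powR_ge0//; lra.
apply: ler_pM; rewrite ?subr_ge0 ?clip_homo ?clipB_le//.
  by rewrite ge0_ler_powR ?nnegrE ?clip_ge0 ?clip_homo//; lra.
rewrite hq; apply: (le_trans (powR_sub_le cu q1)).
by rewrite ler_wpM2l ?clipB_le// -hq.
Qed.

End real_inequalities.

(** * Iterated integrals against a reversible kernel *)

Section iterated_integral.
Context (d : measure_display) (X : measurableType d) (R : realType).
Variables (mu : probability X R) (Q : R.-ker X ~> X).
Hypothesis balance : detailed_balance mu Q.
Implicit Types k : X * X -> \bar R.

Import HBNNSimple.

(** The first clause of [detailed_balance] gives the claim on the level sets of simple functions,
    and monotone limits give the rest. *)
Lemma measurable_integral_kernel k :
  (forall z, 0 <= k z) -> measurable_fun [set: X * X] k ->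
  measurable_fun [set: X] (fun x => \int[Q x]_y k (x, y)).
Proof.
move=> k0 mk; pose k_ := nnsfun_approx measurableT mk.
apply: (measurable_fun_xsection_integral k Q k_).
- by move=> m n mn; exact/nd_nnsfun_approx.
- by move=> z; exact: cvg_nnsfun_approx.
- by move=> n r; exact: balance.1.
Qed.

Lemma measurable_slice k x : measurable_fun [set: X * X] k ->
  measurable_fun [set: X] (fun y => k (x, y)).
Proof. by move=> mk; exact: measurableT_comp. Qed.

(** The map [t] will be the identity or the swap: the two sums then run over the same values and can
    be compared term by term. *)
Let iterated_integral_nnsfun (h : {nnsfun (X * X) >-> R})
    (t : X * X -> X * X) : measurable_fun [set: X * X] t ->
  \int[mu]_x \int[Q x]_y (h (t (x, y)))%:E =
  \sum_(r \in range h)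
    r%:E * \int[mu]_x Q x (xsection (t @^-1` (h @^-1` [set r])) x).
Proof.
move=> mt; pose A r := t @^-1` (h @^-1` [set r]).
(* The interchange of sum and integral asks for nonnegative summands at every real [r]; those with
   [r < 0] vanish. *)
have A0 r : (r < 0)%R -> A r = set0.
  by move=> r0; rewrite /A preimage_nnfun0// preimage_set0.
have mA r : measurable (A r) by rewrite -[A r]setTI; exact: mt.
transitivity (\int[mu]_x \sum_(r \in range h) r%:E * Q x (xsection (A r) x)).
  apply: eq_integral => x _.
  under eq_integral do rewrite fimfunE -fsumEFin//.
  have mhr r : measurable_fun [set: X]
      (fun y => \1_(h @^-1` [set r]) (t (x, y)) : R).
    by apply: measurableT_comp => //; exact: measurableT_comp.
  rewrite ge0_integral_fsum//; last 2 first.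
  - by move=> r; apply/measurable_EFinP; exact: measurable_funM.
  - by move=> r y _; rewrite EFinM nnfun_muleindic_ge0.
  apply: eq_fsbigr => r _.
  have [r0|r0] := leP 0%R r; last first.
    rewrite A0// xsection0 measure0 mule0 integral0_eq// => y _.
    by rewrite preimage_nnfun0// indic0 mulr0.
  under eq_integral do rewrite EFinM.
  rewrite ge0_integralZl_EFin//; last exact/measurable_EFinP.
  congr (_ * _); rewrite -[xsection _ _]setIT -integral_indic//; last first.
    exact: measurable_xsection.
  apply: eq_integral => y _; rewrite !indicE mem_xsection.
  by congr ((_ : bool)%:R)%:E; apply/idP/idP; rewrite !inE.
rewrite ge0_integral_fsum//; last 2 first.
- by move=> r; apply: measurable_funeM; exact: balance.1.
- move=> r x _; have [r0|r0] := leP 0%R r; first exact: mule_ge0.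
  by rewrite A0// xsection0 measure0 mule0.
apply: eq_fsbigr => r _; have [r0|r0] := leP 0%R r.
  by rewrite ge0_integralZl_EFin//; exact: balance.1.
rewrite -/(A r) A0// integral0_eq; last first.
  by move=> x _; rewrite xsection0 measure0 mule0.
by rewrite integral0_eq ?mule0// => x _; rewrite xsection0 measure0.
Qed.

(** Monotone convergence is applied twice, first under each [Q x] and then under [mu]. *)
Let cvg_iterated_integral (k_ : (X * X -> R)^nat) k :
  (forall n, measurable_fun [set: X * X] (k_ n)) ->
  (forall n z, 0 <= k_ n z)%R ->
  (forall z, nondecreasing_seq (k_ ^~ z)) ->
  (forall z, (k_ n z)%:E @[n --> \oo] --> k z) ->
  \int[mu]_x \int[Q x]_y (k_ n (x, y))%:E @[n --> \oo] -->
  \int[mu]_x \int[Q x]_y k (x, y).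
Proof.
move=> mk k0 ndk kk.
have mkn n : measurable_fun [set: X * X] (fun z => (k_ n z)%:E).
  exact/measurable_EFinP.
have cvgQ x :
    \int[Q x]_y (k_ n (x, y))%:E @[n --> \oo] --> \int[Q x]_y k (x, y).
  rewrite (_ : (fun y => k (x, y)) = fun y => limn (fun n => (k_ n (x, y))%:E)).
    apply: cvg_monotone_convergence => //.
    - by move=> n; apply: measurable_slice (mkn n).
    - by move=> n y _; rewrite lee_fin.
    - by move=> y _ m n mn; rewrite lee_fin; exact: ndk.
  by apply/funext => y; apply/esym/cvg_lim => //; exact: kk.
rewrite (_ : (fun x => \int[Q x]_y k (x, y)) =
    fun x => limn (fun n => \int[Q x]_y (k_ n (x, y))%:E)); last first.
  by apply/funext => x; apply/esym/cvg_lim => //; exact: cvgQ.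
apply: (@cvg_monotone_convergence _ _ _ mu setT measurableT
  (fun n x => \int[Q x]_y (k_ n (x, y))%:E)).
- move=> n; apply: (@measurable_integral_kernel (fun z => (k_ n z)%:E)) => //.
  by move=> z; rewrite lee_fin.
- by move=> n x _; apply: integral_ge0 => y _; rewrite lee_fin.
- move=> x _ m n mn; apply: ge0_le_integral => //.
  + by move=> y _; rewrite lee_fin.
  + by apply: measurable_slice (mkn m).
  + by apply: measurable_slice (mkn n).
  + by move=> y _; rewrite lee_fin; exact: ndk.
Qed.

(** On indicators this is detailed balance; it passes to simple functions by linearity and to [k] by
    monotone approximation. *)
Lemma iterated_integral_swap k :
  (forall z, 0 <= k z) -> measurable_fun [set: X * X] k ->
  \int[mu]_x \int[Q x]_y k (x, y) = \int[mu]_x \int[Q x]_y k (y, x).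
Proof.
move=> k0 mk; pose k_ := nnsfun_approx measurableT mk.
have mswap : measurable_fun [set: X * X] (@swap_pair X X).
  exact: measurable_swap.
have ndk z : nondecreasing_seq (fun n => k_ n z).
  by move=> m n mn; exact/lefP/nd_nnsfun_approx.
have kk z : (k_ n z)%:E @[n --> \oo] --> k z by exact: cvg_nnsfun_approx.
have mks n : measurable_fun [set: X * X] (k_ n \o @swap_pair X X).
  exact: measurableT_comp (measurable_funPT (k_ n)) mswap.
have cs : \int[mu]_x \int[Q x]_y (k_ n (y, x))%:E @[n --> \oo] -->
    \int[mu]_x \int[Q x]_y k (y, x).
  apply: (@cvg_iterated_integral (fun n => k_ n \o @swap_pair X X)
    (k \o @swap_pair X X) mks) => [n z|z|z]; first by rewrite /=.
  - exact: ndk.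
  - exact: kk.
have c : \int[mu]_x \int[Q x]_y (k_ n (x, y))%:E @[n --> \oo] -->
    \int[mu]_x \int[Q x]_y k (x, y).
  exact: (@cvg_iterated_integral (fun n => k_ n) k).
apply: (cvg_unique (@ereal_hausdorff R) c); move: cs; apply: cvg_trans.
apply: near_eq_cvg; apply: nearW => n.
rewrite (@iterated_integral_nnsfun (k_ n) (@swap_pair X X))//.
rewrite (@iterated_integral_nnsfun (k_ n) id)//.
apply: eq_fsbigr => r _; congr (_ * _).
rewrite [RHS](balance.2 (k_ n @^-1` [set r]))//.
Qed.

(** The factor 2 arises because [k] and its transpose have the same iterated integral. *)
Lemma iterated_integral_le_sym (h k : X * X -> \bar R) :
  (forall z, 0 <= h z) -> measurable_fun [set: X * X] h ->
  (forall z, 0 <= k z) -> measurable_fun [set: X * X] k ->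
  (forall x y, h (x, y) <= k (x, y) + k (y, x)) ->
  \int[mu]_x \int[Q x]_y h (x, y) <= 2%:E * \int[mu]_x \int[Q x]_y k (x, y).
Proof.
move=> h0 mh k0 mk hk.
have mks : measurable_fun [set: X * X] (k \o @swap_pair X X).
  by apply: (measurableT_comp mk); exact: measurable_swap.
have mK : measurable_fun [set: X] (fun x => \int[Q x]_y k (x, y)).
  exact: measurable_integral_kernel.
have mKs : measurable_fun [set: X] (fun x => \int[Q x]_y k (y, x)).
  apply: (@measurable_integral_kernel (k \o @swap_pair X X)) => // z.
  exact: k0.
rewrite mule_natl mule2n [X in _ + X](iterated_integral_swap k0 mk).
rewrite -ge0_integralD//; last 2 first.
- by move=> x _; apply: integral_ge0 => y _; exact: k0.
- by move=> x _; apply: integral_ge0 => y _; exact: k0.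
apply: ge0_le_integral => //.
- by move=> x _; apply: integral_ge0 => y _; exact: h0.
- exact: measurable_integral_kernel.
- exact: emeasurable_funD.
move=> x _; rewrite -ge0_integralD//; first last.
- exact: (@measurable_slice (k \o @swap_pair X X)).
- exact: measurable_slice.
apply: ge0_le_integral => //; first exact: measurable_slice.
apply: emeasurable_funD; first exact: measurable_slice.
exact: (@measurable_slice (k \o @swap_pair X X)).
Qed.

Lemma measurable_Gamma_plus (f : X -> R) :
  measurable_fun [set: X] f -> measurable_fun [set: X] (Gamma_plus Q f).
Proof.
move=> mf.
apply: (@measurable_integral_kernel
  (fun z => ((Num.max (f z.1 - f z.2) 0) ^+ 2)%R%:E)).
  by move=> z; rewrite lee_fin sqr_ge0.
apply/measurable_EFinP; apply: measurable_funX; apply: measurable_maxr => //.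
by apply: measurable_funB; exact: measurableT_comp.
Qed.

Lemma Gamma_plus_ge0 (f : X -> R) x : 0 <= Gamma_plus Q f x.
Proof. by apply: integral_ge0 => y _; rewrite lee_fin sqr_ge0. Qed.

(** The half of the bound carrying [w x] integrates over [y] to [w x] times [Gamma_plus Q f x]. The
    factor 2 will cancel the 1/2 of [dirichlet_form]. *)
Lemma iterated_integral_le_Gamma_plus (f w : X -> R) (h : X * X -> R) :
  measurable_fun [set: X] f ->
  measurable_fun [set: X] w -> (forall x, 0 <= w x)%R ->
  measurable_fun [set: X * X] h -> (forall z, 0 <= h z)%R ->
  (forall x y, h (x, y) <= w x * Num.max (f x - f y) 0 ^+ 2 +
                           w y * Num.max (f y - f x) 0 ^+ 2)%R ->
  \int[mu]_x \int[Q x]_y (h (x, y))%:E <=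
    2%:E * \int[mu]_x ((w x)%:E * Gamma_plus Q f x).
Proof.
move=> mf mw w0 mh h0 hw.
pose k z : \bar R := (w z.1 * Num.max (f z.1 - f z.2) 0 ^+ 2)%R%:E.
have k0 z : 0 <= k z by rewrite lee_fin mulr_ge0// sqr_ge0.
have mG : measurable_fun [set: X * X]
    (fun z => Num.max (f z.1 - f z.2) 0 ^+ 2)%R.
  apply: measurable_funX; apply: measurable_maxr => //.
  by apply: measurable_funB; exact: measurableT_comp.
have mk : measurable_fun [set: X * X] k.
  apply/measurable_EFinP; apply: measurable_funM => //.
  exact: measurableT_comp.
have -> : \int[mu]_x ((w x)%:E * Gamma_plus Q f x) =
    \int[mu]_x \int[Q x]_y k (x, y).
  apply: eq_integral => x _; rewrite -ge0_integralZl_EFin//.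
    by move=> y _; rewrite lee_fin sqr_ge0.
  apply/measurable_EFinP.
  exact: (measurableT_comp mG (measurable_pair1 x)).
apply: (@iterated_integral_le_sym (EFin \o h)) => //.
exact/measurable_EFinP.
Qed.

(** The weight is 1, a square being the sum of the squares of the positive and negative parts. *)
Lemma dirichlet_dom_Gamma_plus (f : X -> R) : measurable_fun [set: X] f ->
  \int[mu]_x Gamma_plus Q f x < +oo -> dirichlet_dom mu Q f.
Proof.
move=> mf Goo; split; first exact: mf.
apply: (@le_lt_trans _ _
    (2%:E * \int[mu]_x ((cst 1%R x)%:E * Gamma_plus Q f x))).
  apply: (@iterated_integral_le_Gamma_plus f (cst 1%R)
    (fun z => (f z.2 - f z.1) ^+ 2)%R) => //.
  - apply: measurable_funX.
    by apply: measurable_funB; exact: measurableT_comp.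
  - by move=> z; rewrite sqr_ge0.
  - by move=> x y /=; rewrite !mul1r -(opprB (f x)) sqrrN sqr_max_sqr_maxN.
under eq_integral do rewrite mul1e.
by rewrite lte_mul_pinfty.
Qed.

Lemma dirichlet_dom_lipschitz (L : R) (f h : X -> R) :
  measurable_fun [set: X] h ->
  (forall x y, `|h y - h x| <= L * `|f y - f x|)%R ->
  dirichlet_dom mu Q f -> dirichlet_dom mu Q h.
Proof.
move=> mh hf [mf foo]; split; first exact: mh.
have mD (g : X -> R) : measurable_fun [set: X] g ->
    measurable_fun [set: X * X] (fun z => ((g z.2 - g z.1) ^+ 2)%R%:E).
  move=> mg; apply/measurable_EFinP/measurable_funX.
  by apply: measurable_funB; exact: measurableT_comp.
apply: (@le_lt_trans _ _
    (\int[mu]_x ((L ^+ 2)%:E * \int[Q x]_y ((f y - f x) ^+ 2)%R%:E))).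
  apply: ge0_le_integral => //.
  - by move=> x _; apply: integral_ge0 => y _; rewrite lee_fin sqr_ge0.
  - apply: (measurable_integral_kernel _ (mD _ mh)) => z.
    by rewrite lee_fin sqr_ge0.
  - apply: measurable_funeM.
    apply: (measurable_integral_kernel _ (mD _ mf)) => z.
    by rewrite lee_fin sqr_ge0.
  move=> x _; rewrite -ge0_integralZl_EFin ?sqr_ge0//; last 2 first.
  - by move=> y _; rewrite lee_fin sqr_ge0.
  - exact: measurable_slice (mD _ mf).
  apply: ge0_le_integral => //.
  - by move=> y _; rewrite lee_fin sqr_ge0.
  - exact: measurable_slice (mD _ mh).
  - by apply: measurable_funeM; exact: measurable_slice (mD _ mf).
  move=> y _; rewrite -EFinM lee_fin -exprMn -real_normK ?num_real//.
  rewrite -[leRHS]real_normK ?num_real// lerXn2r ?nnegrE//.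
  by rewrite (le_trans (hf x y))// normrM ler_wpM2r// ler_norm.
rewrite ge0_integralZl_EFin ?sqr_ge0//; last 2 first.
- by move=> x _; apply: integral_ge0 => y _; rewrite lee_fin sqr_ge0.
- apply: (measurable_integral_kernel _ (mD _ mf)) => z.
  by rewrite lee_fin sqr_ge0.
by rewrite lte_mul_pinfty// lee_fin sqr_ge0.
Qed.

End iterated_integral.

(** * Moments on a probability space *)

Section probability_moments.
Context (d : measure_display) (X : measurableType d) (R : realType).
Variable mu : probability X R.
Implicit Types u v : X -> R.

Lemma measurable_powR_comp u (p : R) : measurable_fun [set: X] u ->
  measurable_fun [set: X] (fun x => u x `^ p)%R.
Proof. exact: (@measurableT_comp _ _ _ _ _ _ (@powR R ^~ p)). Qed.

Lemma ge0_Lnorm u (p : R) : (forall x, 0 <= u x)%R ->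
  'N[mu]_p%:E[EFin \o u] = (\int[mu]_x (u x `^ p)%:E) `^ p^-1.
Proof.
move=> u0; rewrite Lnorm.unlock; apply: (congr1 (poweR ^~ _)).
apply: eq_integral => x _.
by rewrite /comp abse_EFin ger0_norm.
Qed.

Lemma ge0_hoelder u v (p q : R) :
  measurable_fun [set: X] u -> measurable_fun [set: X] v ->
  (forall x, 0 <= u x)%R -> (forall x, 0 <= v x)%R ->
  (0 < p)%R -> (0 < q)%R -> (p^-1 + q^-1 = 1)%R ->
  \int[mu]_x (u x * v x)%:E <=
    (\int[mu]_x (u x `^ p)%:E) `^ p^-1 * (\int[mu]_x (v x `^ q)%:E) `^ q^-1.
Proof.
move=> mu_ mv u0 v0 p0 q0 pq; rewrite -!ge0_Lnorm//.
apply: le_trans (hoelder mu mu_ mv p0 q0 pq); rewrite Lnorm1.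
rewrite le_eqVlt; apply/orP; left; apply/eqP; apply: eq_integral => x _.
by rewrite /comp abse_EFin ger0_norm ?mulr_ge0.
Qed.

Lemma poweR_integral_le u (p q : R) : measurable_fun [set: X] u ->
  (forall x, 0 <= u x)%R -> (0 < p)%R -> (p <= q)%R ->
  (\int[mu]_x (u x `^ p)%:E) `^ p^-1 <= (\int[mu]_x (u x `^ q)%:E) `^ q^-1.
Proof.
move=> mu_ u0 p0; rewrite le_eqVlt => /predU1P[->//|pq].
have q0 : (0 < q)%R by rewrite (lt_trans p0).
have qp0 : (0 < q - p)%R by rewrite subr_gt0.
have := @ge0_hoelder (fun x => u x `^ p)%R (cst 1%R) (q / p) (q / (q - p)).
have -> : ((q / p)^-1 + (q / (q - p))^-1 = 1)%R.
  by rewrite !invf_div; field; rewrite gt_eqF.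
move=> /(_ (measurable_powR_comp _ mu_) (measurable_cst _)).
move=> /(_ (fun=> powR_ge0 _ _) (fun=> ler01) (divr_gt0 q0 p0)).
move=> /(_ (divr_gt0 q0 qp0) erefl).
under eq_integral do rewrite mulr1.
under [X in X `^ _ * _]eq_integral => x _.
  rewrite -powRrM (_ : p * (q / p) = q)%R; last by field; rewrite gt_eqF.
  over.
under [X in _ * X `^ _]eq_integral do rewrite powR1.
have -> : \int[mu]__ 1%:E = 1.
  by rewrite integral_cst// mul1e; exact: probability_setT.
rewrite poweR1r mule1 => le_pq.
rewrite (_ : q^-1 = (q / p)^-1 * p^-1)%R; last first.
  by field; rewrite ?gt_eqF.
rewrite poweRrM gt0_ler_poweR ?invr_ge0 ?(ltW p0)//.
- rewrite in_itv/= leey andbT; apply: integral_ge0 => x _.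
  by rewrite lee_fin powR_ge0.
- by rewrite in_itv/= leey poweR_ge0.
Qed.

Lemma bounded_integrable u (n : R) : measurable_fun [set: X] u ->
  (forall x, 0 <= u x <= n)%R -> mu.-integrable [set: X] (EFin \o u).
Proof.
move=> mu_ un; apply: measurable_bounded_integrable => //.
- by apply: le_lt_trans (ltry 1%R); exact: probability_le1.
- exists n; split; first exact: num_real.
  move=> M nM x _ /=; have /andP[u0 uxn] := un x.
  by rewrite ger0_norm// (le_trans uxn)// ltW.
Qed.

Lemma integrable_EFin_Rintegral u : mu.-integrable [set: X] (EFin \o u) ->
  \int[mu]_x (u x)%:E = (\int[mu]_x u x)%R%:E.
Proof. by move=> iu; rewrite /Rintegral fineK//; exact: integrable_fin_num. Qed.

Lemma integrable_EFin_cst (c : R) : mu.-integrable [set: X] (EFin \o cst c).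
Proof. exact: finite_measure_integrable_cst. Qed.

Lemma Rintegral_probability_cst (c : R) : (\int[mu]_x c = c)%R.
Proof.
rewrite Rintegral_cst// -[RHS]mulr1; congr *%R.
exact: (congr1 fine (probability_setT mu)).
Qed.

Lemma integrable_EFinD u v :
  mu.-integrable [set: X] (EFin \o u) -> mu.-integrable [set: X] (EFin \o v) ->
  mu.-integrable [set: X] (EFin \o (fun x => u x + v x)%R).
Proof.
move=> iu iv; have := integrableD measurableT iu iv.
by apply: eq_integrable => // x _ /=; rewrite EFinD.
Qed.

Lemma integrable_EFinZ (c : R) u :
  mu.-integrable [set: X] (EFin \o u) ->
  mu.-integrable [set: X] (EFin \o (fun x => c * u x)%R).
Proof.
move=> iu; have := integrableZl measurableT c iu.
by apply: eq_integrable => // x _ /=; rewrite EFinM.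
Qed.

(** An integrable power is finite almost everywhere. [Gamma_plus] may take the value [+oo], and this
    allows replacing it by a real function in Hoelder's inequality. *)
Lemma fin_num_Lnorm_fine (G : X -> \bar R) (p : R) : (0 < p)%R ->
  measurable_fun [set: X] G -> (forall x, 0 <= G x) ->
  'N[mu]_p%:E[G] \is a fin_num ->
  {ae mu, forall x, G x = (fine (G x))%:E}.
Proof.
move=> p0 mG G0; rewrite unlock => Gfin.
have Gp0 x : 0 <= G x `^ p by exact: poweR_ge0.
have mGp : measurable_fun [set: X] (fun x => `|G x| `^ p).
  apply: (@measurableT_comp _ _ _ _ _ _ (fun x => x `^ p)).
    exact: measurable_poweR.
  exact: measurableT_comp.
have iG : mu.-integrable [set: X] (fun x => `|G x| `^ p).
  apply/integrableP; split => //.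
  under eq_integral do rewrite gee0_abs ?poweR_ge0//.
  apply: (@lty_poweRy _ _ p^-1); first by rewrite invr_neq0// gt_eqF.
  by move: Gfin; rewrite fin_numE => /andP[_]; rewrite ltey.
have := integrable_ae measurableT iG.
apply: filterS => x /(_ Logic.I); rewrite ge0_fin_numE ?poweR_ge0// => Gx.
rewrite fineK// ge0_fin_numE//.
by have /lty_poweRy := Gx; rewrite gt_eqF// => /(_ isT); rewrite gee0_abs.
Qed.

(** Hoelder's inequality with exponents [q / (q - 2)] and [q / 2], followed by the growth of the
    norm of [G] from order [q / 2] to [r / 2]. *)
Lemma integral_weight_le (w : X -> R) (G : X -> \bar R) (q r : R) :
  (2 <= q <= r)%R ->
  measurable_fun [set: X] w -> (forall x, 0 <= w x)%R ->
  measurable_fun [set: X] G -> (forall x, 0 <= G x) ->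
  'N[mu]_(r / 2)%:E[G] \is a fin_num ->
  \int[mu]_x ((w x `^ (q - 2))%:E * G x) <=
    (\int[mu]_x (w x `^ q)%:E) `^ ((q - 2) / q) * 'N[mu]_(r / 2)%:E[G].
Proof.
move=> /andP[q2 qr] mw w0 mG G0 Gfin.
have q0 : (0 < q)%R by rewrite (lt_le_trans _ q2).
have r2 : (0 < r / 2)%R by rewrite divr_gt0// (lt_le_trans q0).
pose g x := fine (G x).
have mg : measurable_fun [set: X] g by exact: measurableT_comp.
have g0 x : (0 <= g x)%R by rewrite fine_ge0.
have Gg := fin_num_Lnorm_fine r2 mG G0 Gfin.
have -> : 'N[mu]_(r / 2)%:E[G] = (\int[mu]_x (g x `^ (r / 2))%:E) `^ (r / 2)^-1.
  rewrite unlock; congr (_ `^ _); apply: ge0_ae_eq_integral => //.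
  - apply: (@measurableT_comp _ _ _ _ _ _ (fun x => x `^ (r / 2))).
      exact: measurable_poweR.
    exact: measurableT_comp.
  - exact/measurable_EFinP/measurable_powR_comp.
  - by move=> x _; exact: poweR_ge0.
  - by move=> x _; rewrite lee_fin powR_ge0.
  - by apply: filterS Gg => x -> _; rewrite /g/= ger0_norm ?fine_ge0.
rewrite (@ge0_ae_eq_integral _ _ _ mu setT _
  (fun x => (w x `^ (q - 2) * g x)%:E))//.
- apply: (@le_trans _ _ ((\int[mu]_x (w x `^ q)%:E) `^ ((q - 2) / q) *
    (\int[mu]_x (g x `^ (q / 2))%:E) `^ (q / 2)^-1)); last first.
    rewrite lee_wpmul2l ?poweR_ge0// poweR_integral_le//.
      by rewrite divr_gt0.
    by rewrite ler_pM2r.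
  (* At [q = 2] the first exponent degenerates; there the weight and the power in front are both
     zeroth powers, equal to 1. *)
  move: q2; rewrite le_eqVlt => /predU1P[<-|q2].
    rewrite subrr mul0r poweRe0 mul1e divff// invr1 poweRe1; last first.
      by apply: integral_ge0 => x _; rewrite lee_fin powR_ge0.
    by under eq_integral do rewrite powRr0 mul1r -(powRr1 (g0 _)).
  have q20 : (0 < q - 2)%R by rewrite subr_gt0.
  have := @ge0_hoelder (fun x => w x `^ (q - 2))%R g (q / (q - 2)) (q / 2).
  have -> : ((q / (q - 2))^-1 + (q / 2)^-1 = 1)%R.
    by rewrite !invf_div; field; rewrite gt_eqF.
  move=> /(_ (measurable_powR_comp _ mw) mg (fun=> powR_ge0 _ _) g0).
  rewrite !divr_gt0// => /(_ isT isT erefl); rewrite invf_div.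
  under [X in X `^ _ * _]eq_integral => x _.
    rewrite -powRrM (_ : (q - 2) * (q / (q - 2)) = q)%R; last first.
      by field; rewrite gt_eqF.
    over.
  by [].
- apply: emeasurable_funM => //.
  exact/measurable_EFinP/measurable_powR_comp.
- by apply/measurable_EFinP/measurable_funM => //; exact: measurable_powR_comp.
- by move=> x _; rewrite mule_ge0// lee_fin powR_ge0.
- by move=> x _; rewrite lee_fin mulr_ge0// powR_ge0.
- by apply: filterS Gg => x -> _.
Qed.

End probability_moments.

(** * Consequences of the Beckner inequality *)

Section beckner_consequences.
Context (d : measure_display) (X : measurableType d) (R : realType).
Variables (mu : probability X R) (Q : R.-ker X ~> X).
Hypothesis balance : detailed_balance mu Q.
Implicit Types f h : X -> R.

(** The two-sided bound makes the energy finite, which is the premise under which the [estimate] in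
    [beckner] can be used. *)
Lemma dirichlet_form_le f (g h w : X -> R) (D : R) :
  measurable_fun [set: X] f -> measurable_fun [set: X] g ->
  measurable_fun [set: X] h -> measurable_fun [set: X] w ->
  (forall x, 0 <= w x)%R ->
  (forall x y, 0 <= (g y - g x) * (h y - h x))%R ->
  (forall x y, (g y - g x) * (h y - h x) <=
    w x * Num.max (f x - f y) 0 ^+ 2 + w y * Num.max (f y - f x) 0 ^+ 2)%R ->
  \int[mu]_x ((w x)%:E * Gamma_plus Q f x) <= D%:E ->
  0 <= dirichlet_form mu Q g h <= D%:E.
Proof.
move=> mf mg mh mw w0 gh0 ghw wD; rewrite /dirichlet_form; apply/andP; split.
  rewrite mule_ge0 ?lee_fin//; apply: integral_ge0 => x _.
  by apply: integral_ge0 => y _; rewrite lee_fin.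
have -> : D%:E = (2^-1)%:E * (2%:E * D%:E).
  by rewrite -!EFinM mulrA mulVf ?mul1r.
rewrite lee_wpmul2l ?lee_fin//.
apply: (@le_trans _ _ (2%:E * \int[mu]_x ((w x)%:E * Gamma_plus Q f x))).
  apply: (@iterated_integral_le_Gamma_plus _ _ _ _ _ balance f w
    (fun z => (g z.2 - g z.1) * (h z.2 - h z.1))%R) => //.
  by apply: measurable_funM; apply: measurable_funB; exact: measurableT_comp.
by rewrite lee_wpmul2l.
Qed.

(** At [p = 2] the energy is that of [h] with itself. It decreases under contractions, and that of
    [f] is the integral of [Gamma_plus Q f]. *)
Lemma beckner_contraction (alpha D : R) f h : beckner mu Q 2 alpha ->
  measurable_fun [set: X] f -> \int[mu]_x Gamma_plus Q f x <= D%:E ->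
  measurable_fun [set: X] h -> (forall x, 0 <= h x)%R ->
  (forall x y, `|h y - h x| <= `|f y - f x|)%R ->
  [/\ mu.-integrable [set: X] (EFin \o h),
      mu.-integrable [set: X] (EFin \o (fun x => h x ^+ 2)%R) &
      (alpha * (\int[mu]_x (h x ^+ 2) - (\int[mu]_x h x) ^+ 2) <= D)%R].
Proof.
move=> beck mf GD mh h0 hf.
have domf : dirichlet_dom mu Q f.
  by apply: dirichlet_dom_Gamma_plus => //; exact: le_lt_trans GD (ltry _).
have domh : dirichlet_dom mu Q h.
  apply: (@dirichlet_dom_lipschitz _ _ _ _ _ balance 1%R f) => // x y.
  by rewrite mul1r.
have h1E : (fun x => h x `^ (2 - 1))%R = h.
  by apply/funext => x; rewrite (_ : 2 - 1 = 1)%R ?powRr1//; ring.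
have h2E : (fun x => h x `^ 2)%R = (fun x => h x ^+ 2)%R.
  by apply/funext => x; rewrite -powR_mulrn.
have /andP[E0 ED] : 0 <= dirichlet_form mu Q h h <= D%:E.
  apply: (@dirichlet_form_le f h h (cst 1%R) D) => //.
  - by move=> x y; rewrite -expr2 sqr_ge0.
  - move=> x y; rewrite -expr2 !mul1r -(opprB (f x) (f y)) sqr_max_sqr_maxN.
    rewrite -real_normK ?num_real// -[leRHS]real_normK ?num_real//.
    by rewrite lerXn2r ?nnegrE// (distrC (f x)).
  - by under eq_integral do rewrite mul1e.
have := beck h h0 domh; rewrite h1E h2E => /(_ domh).
rewrite divff// mul1e => -[|[ih ih2] hD].
  by rewrite ge0_fin_numE//; exact: le_lt_trans ED (ltry _).
split => //; move: (le_trans hD ED); rewrite lee_fin.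
by rewrite -powR_mulrn// Rintegral_ge0.
Qed.

End beckner_consequences.

(** * Integrability and variance from the case p = 2 *)

Section beckner_moments.
Context (d : measure_display) (X : measurableType d) (R : realType).
Variables (mu : probability X R) (Q : R.-ker X ~> X).
Hypothesis balance : detailed_balance mu Q.
Variables (f : X -> R) (mf : measurable_fun [set: X] f).

(** The absolute value of [f] is a nonnegative contraction of [f]. *)
Lemma beckner_integrable_sqr (alpha D : R) : beckner mu Q 2 alpha ->
  \int[mu]_x Gamma_plus Q f x <= D%:E ->
  mu.-integrable [set: X] (EFin \o f) /\
  mu.-integrable [set: X] (EFin \o (fun x => f x ^+ 2)%R).
Proof.
move=> beck GD.
have [|||if1 if2 _] := @beckner_contraction _ _ _ _ _ balance _ _ f
    (fun x => `|f x|%R) beck mf GD.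
- exact: measurableT_comp.
- by [].
- by move=> x y; exact: ler_dist_dist.
split.
  apply: (le_integrable measurableT _ _ if1); first exact/measurable_EFinP.
  by move=> x _ /=; rewrite normr_id.
apply: (le_integrable measurableT _ _ if2).
  by apply/measurable_EFinP; exact: measurable_funX.
by move=> x _ /=; rewrite real_normK ?num_real.
Qed.

(* [f] is bounded below by [- n] and then translated by [n], as Beckner's
   inequality only speaks of nonnegative functions. *)
Lemma beckner_variance (alpha a D : R) : beckner mu Q 2 alpha ->
  (0 < a <= alpha)%R -> \int[mu]_x Gamma_plus Q f x <= D%:E ->
  \int[mu]_x (Num.max (f x - \int[mu]_z f z) 0 ^+ 2)%R%:E <= (D / a)%:E.
Proof.
move=> beck /andP[a0 aalpha] GD.
have [if1 if2] := beckner_integrable_sqr beck GD.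
have D0 : (0 <= D)%R.
  rewrite -lee_fin; apply: le_trans GD; apply: integral_ge0 => x _.
  exact: Gamma_plus_ge0.
set m := (\int[mu]_z f z)%R.
pose v x : R := ((f x - m) ^+ 2)%R.
have iv : mu.-integrable [set: X] (EFin \o v).
  have -> : v = (fun x => f x ^+ 2 + ((- (2 * m)) * f x + m ^+ 2))%R.
    by apply/funext => x; rewrite /v; ring.
  apply: integrable_EFinD if2 _; apply: integrable_EFinD.
    exact: integrable_EFinZ.
  exact: integrable_EFin_cst.
pose V := (\int[mu]_x v x)%R.
have V0 : (0 <= V)%R by apply: Rintegral_ge0 => x _; exact: sqr_ge0.
pose g x : R := (Num.max (f x - m) 0 ^+ 2)%R.
have mg : measurable_fun [set: X] g.
  apply: measurable_funX; apply: measurable_maxr => //.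
  exact: measurable_funB.
have gv x : (g x <= v x)%R.
  rewrite /g /v; have [|_] := leP (f x - m)%R 0%R; last by [].
  by rewrite expr0n sqr_ge0.
have ig : mu.-integrable [set: X] (EFin \o g).
  apply: (le_integrable measurableT _ _ iv); first exact/measurable_EFinP.
  by move=> x _ /=; rewrite lee_fin !ger0_norm ?gv ?sqr_ge0.
rewrite (integrable_EFin_Rintegral ig) lee_fin.
apply/ler_addgt0Pr => e e0.
(* By [sqr_div_le] this level gives [(V / n) ^+ 2 <= e], which bounds the effect of the truncation
   on the mean. *)
pose n : R := ((V + 1) * (1 + e^-1))%R.
have ei0 : (0 < e^-1)%R by rewrite invr_gt0.
have n0 : (0 < n)%R by rewrite /n mulr_gt0//; lra.
pose F x : R := Num.max (f x - m + n)%R 0%R.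
have mF : measurable_fun [set: X] F.
  apply: measurable_maxr => //; apply: measurable_funD => //.
  exact: measurable_funB.
have F0 x : (0 <= F x)%R by rewrite le_max lexx orbT.
have Flip x y : (`|F y - F x| <= `|f y - f x|)%R.
  have -> : (f y - f x = (f y - m + n) - (f x - m + n))%R by ring.
  exact: max0_lipschitz.
have [iF iF2 varF] :=
  @beckner_contraction _ _ _ _ _ balance _ _ f F beck mf GD mF F0 Flip.
(* With [t = f x - m], the upper bound is [(t ^+ 2 + n * t + n ^+ 2) / n], nonnegative by completing
   the square. Integration places the mean of [F] between [n] and [n + V / n]. *)
have F1 x : (f x - m + n <= F x <= f x - m + n + v x / n)%R.
  rewrite /F le_max lexx/= ge_max; apply/andP; split.
    by rewrite lerDl divr_ge0 ?sqr_ge0// ltW.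
  have -> : (f x - m + n + v x / n =
      ((f x - m + n / 2) ^+ 2 + 3 / 4 * n ^+ 2) / n)%R.
    by rewrite /v; field; rewrite gt_eqF.
  by rewrite divr_ge0 ?(ltW n0)// addr_ge0 ?sqr_ge0// mulr_ge0 ?sqr_ge0.
have ilin : mu.-integrable [set: X] (EFin \o (fun x => f x - m + n)%R).
  apply: integrable_EFinD; last exact: integrable_EFin_cst.
  by apply: integrable_EFinD => //; exact: integrable_EFin_cst.
have ivn : mu.-integrable [set: X] (EFin \o (fun x => v x / n)%R).
  rewrite (_ : (fun x => v x / n)%R = (fun x => n^-1 * v x)%R).
    exact: integrable_EFinZ.
  by apply/funext => x; rewrite mulrC.
have ilin2 :
    mu.-integrable [set: X] (EFin \o (fun x => f x - m + n + v x / n)%R).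
  exact: integrable_EFinD.
have lin : (\int[mu]_x (f x - m + n) = n)%R.
  under eq_Rintegral do rewrite -addrA.
  rewrite RintegralD//; last exact: integrable_EFin_cst.
  by rewrite Rintegral_probability_cst -/m; ring.
have lin2 : (\int[mu]_x (f x - m + n + v x / n) = n + V / n)%R.
  by rewrite RintegralD// lin RintegralZr.
pose w := (\int[mu]_x F x)%R.
have wn : (n <= w <= n + V / n)%R.
  rewrite -{1}lin -lin2; apply/andP; split; apply: le_Rintegral => // x _.
    by have /andP[] := F1 x.
  by have /andP[] := F1 x.
(* The right-hand side is [(F x - n) ^+ 2], expanded for integration; its integral is the variance
   of [F] plus [(w - n) ^+ 2]. *)
have Fn x : (g x <= F x ^+ 2 + ((- (2 * n)) * F x + n ^+ 2))%R.
  have -> : (F x ^+ 2 + ((- (2 * n)) * F x + n ^+ 2) = (F x - n) ^+ 2)%R.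
    by ring.
  have /andP[Fl _] := F1 x.
  rewrite /g; have [fm|fm] := leP (f x - m)%R 0%R.
    by rewrite expr0n sqr_ge0.
  have fF : (f x - m <= F x - n)%R by rewrite lerBrDr.
  have fm0 := ltW fm.
  by rewrite lerXn2r ?nnegrE// (le_trans fm0).
have i2 : mu.-integrable [set: X] (EFin \o (fun x => - (2 * n) * F x)%R).
  exact: integrable_EFinZ.
have i3 :
    mu.-integrable [set: X] (EFin \o (fun x => - (2 * n) * F x + n ^+ 2)%R).
  by apply: integrable_EFinD => //; exact: integrable_EFin_cst.
have gle : (\int[mu]_x g x <=
    \int[mu]_x (F x ^+ 2) + (- (2 * n) * w + n ^+ 2))%R.
  have <- : (\int[mu]_x (F x ^+ 2 + ((- (2 * n)) * F x + n ^+ 2)) =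
      \int[mu]_x (F x ^+ 2) + (- (2 * n) * w + n ^+ 2))%R.
    rewrite RintegralD//; congr (_ + _)%R.
    rewrite RintegralD//; last exact: integrable_EFin_cst.
    by rewrite Rintegral_probability_cst RintegralZl.
  apply: le_Rintegral => //.
  exact: integrable_EFinD.
have var : (\int[mu]_x (F x ^+ 2) - w ^+ 2 <= D / a)%R.
  (* Replacing [alpha] by the smaller [a] needs a nonnegative factor; otherwise the bound is
     trivial. *)
  have [s0|s0] := leP (\int[mu]_x (F x ^+ 2) - w ^+ 2)%R 0%R.
    by rewrite (le_trans s0)// divr_ge0// ltW.
  by rewrite ler_pdivlMr// mulrC (le_trans _ varF)// ler_wpM2r// ltW.
have wn2 : ((w - n) ^+ 2 <= e)%R.
  apply: le_trans (sqr_div_le V0 e0); have /andP[nw wnV] := wn.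
  by rewrite lerXn2r ?nnegrE ?lerBlDl// ?subr_ge0// divr_ge0// ltW.
have : ((w - n) ^+ 2 = w ^+ 2 + (- (2 * n) * w + n ^+ 2))%R by ring.
lra.
Qed.

End beckner_moments.

(** * Moments of the clipped deviation *)

Section clipped_moments.
Context (d : measure_display) (X : measurableType d) (R : realType).
Variables (mu : probability X R) (Q : R.-ker X ~> X).
Hypothesis balance : detailed_balance mu Q.
Variables (f : X -> R) (r : R).
Hypothesis mf : measurable_fun [set: X] f.
Hypothesis Gfin : 'N[mu]_(r / 2)%:E[Gamma_plus Q f] \is a fin_num.

Lemma measurable_clip m n :
  measurable_fun [set: X] (fun x => clip m n (f x)).
Proof.
apply: measurable_minr => //; apply: measurable_maxr => //.
exact: measurable_funB.
Qed.

Lemma integrable_clip_powR m n t : (0 <= n)%R -> (0 <= t)%R ->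
  mu.-integrable [set: X] (EFin \o (fun x => clip m n (f x) `^ t)%R).
Proof.
move=> n0 t0; apply: (@bounded_integrable _ _ _ _ _ (n `^ t)%R).
  exact/measurable_powR_comp/measurable_clip.
move=> x; rewrite powR_ge0/= ge0_ler_powR ?nnegrE ?clip_ge0//.
exact: clip_le.
Qed.

(** The case of order 2 and weight 1 of [integral_weight_le]. *)
Lemma integral_Gamma_plus_le : (2 <= r)%R ->
  \int[mu]_x Gamma_plus Q f x <= 'N[mu]_(r / 2)%:E[Gamma_plus Q f].
Proof.
move=> r2; have r22 : ((2 : R) <= 2 <= r)%R by apply/andP; split.
have := integral_weight_le r22 (measurable_cst (1%R : R)) (fun=> ler01)
  (measurable_Gamma_plus balance mf) (Gamma_plus_ge0 Q f) Gfin.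
rewrite subrr mul0r poweRe0 mul1e.
by under eq_integral do rewrite powRr0 mul1e.
Qed.

Lemma beckner_clip_moment (alpha a s q m n : R) :
  beckner mu Q (q / (q - 1)) alpha -> (0 < a)%R ->
  (a * (q / (q - 1) - 1) `^ s <= alpha)%R -> (2 <= q <= r)%R -> (0 <= n)%R ->
  (\int[mu]_x (clip m n (f x) `^ q) <=
    (\int[mu]_x (clip m n (f x) `^ (q - 1))) `^ (q / (q - 1)) +
    q / 2 * ((q - 1) `^ s / a) * fine 'N[mu]_(r / 2)%:E[Gamma_plus Q f] *
      (\int[mu]_x (clip m n (f x) `^ q)) `^ ((q - 2) / q))%R.
Proof.
move=> beck a0 aalpha /[dup] q2r /andP[q2 qr] n0.
have r2 : (2 <= r)%R by exact: le_trans qr.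
have q10 : (0 < q - 1)%R by lra.
have q0 : (0 < q)%R by lra.
pose g x := clip m n (f x).
have g0 x : (0 <= g x)%R by exact: clip_ge0.
have mg : measurable_fun [set: X] g by exact: measurable_clip.
pose h x := (g x `^ (q - 1))%R.
have mh : measurable_fun [set: X] h by exact: measurable_powR_comp.
have mG := measurable_Gamma_plus balance mf.
have domf : dirichlet_dom mu Q f.
  apply: dirichlet_dom_Gamma_plus => //.
  by apply: le_lt_trans (integral_Gamma_plus_le r2) _; rewrite ltey_eq Gfin.
have domg : dirichlet_dom mu Q g.
  apply: (dirichlet_dom_lipschitz (L := 1%R) balance mg) domf => x y.
  by rewrite mul1r clip_lipschitz.
have domh : dirichlet_dom mu Q h.
  apply: (dirichlet_dom_lipschitz
    (L := ((q - 1) * n `^ (q - 1 - 1))%R) balance mh) domf => x y.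
  by apply: clip_powR_lipschitz => //; lra.
(* Thus the energy in Beckner's inequality for [h] pairs [h] with [g], and its left-hand side
   contains the moments of [g] of orders [q] and [q - 1]. *)
have hg : (fun x => h x `^ (q / (q - 1) - 1))%R = g.
  apply/funext => x; rewrite /h -powRrM.
  rewrite (_ : (q - 1) * (q / (q - 1) - 1) = 1)%R ?powRr1//.
  by field; rewrite gt_eqF.
have hq : (fun x => h x `^ (q / (q - 1)))%R = (fun x => g x `^ q)%R.
  apply/funext => x; rewrite /h -powRrM; congr (_ `^ _)%R.
  by field; rewrite gt_eqF.
pose k : R := fine 'N[mu]_(r / 2)%:E[Gamma_plus Q f].
have kE : k%:E = 'N[mu]_(r / 2)%:E[Gamma_plus Q f] by rewrite /k fineK.
have k0 : (0 <= k)%R by rewrite fine_ge0// Lnorm_ge0.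
pose M t : R := (\int[mu]_x (g x `^ t))%R.
have M0 t : (0 <= M t)%R by apply: Rintegral_ge0 => x _; exact: powR_ge0.
pose D : R := ((q - 1) * (M q `^ ((q - 2) / q) * k))%R.
have D0 : (0 <= D)%R by rewrite !mulr_ge0 ?powR_ge0 ?(ltW q10).
have /andP[E0 ED] : 0 <= dirichlet_form mu Q h g <= D%:E.
  apply: (dirichlet_form_le balance (f := f)
    (w := fun x => (q - 1) * g x `^ (q - 2))%R) => //.
  - by apply: measurable_funM => //; exact: measurable_powR_comp.
  - by move=> x; rewrite mulr_ge0 ?powR_ge0// ltW.
  (* Both [g] and [h] are nondecreasing functions of [f], so their increments have the same sign. *)
  - have gh x y : (f x <= f y)%R -> (g x <= g y)%R /\ (h x <= h y)%R.
      move=> fxy; have gxy : (g x <= g y)%R by exact: clip_homo.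
      by rewrite /h ge0_ler_powR ?nnegrE ?(ltW q10).
    move=> x y; have [/gh[gxy hxy]|/ltW/gh[gxy hxy]] := leP (f x) (f y).
      by rewrite mulr_ge0// subr_ge0.
    by rewrite mulr_le0// subr_le0.
  - by move=> x y; exact: clip_powR_sub_mul_le.
  under eq_integral do rewrite EFinM -muleA.
  rewrite ge0_integralZl_EFin ?(ltW q10)//; last 2 first.
  - by move=> x _; rewrite mule_ge0 ?lee_fin ?powR_ge0 ?Gamma_plus_ge0.
  - apply: emeasurable_funM mG.
    exact/measurable_EFinP/measurable_powR_comp.
  rewrite EFinM lee_pmul2l// ?lte_fin//.
  have := integral_weight_le q2r mg g0 (measurable_Gamma_plus balance mf)
    (Gamma_plus_ge0 Q f) Gfin.
  rewrite integrable_EFin_Rintegral; last first.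
    exact: integrable_clip_powR (ltW q0).
  by rewrite poweR_EFin -kE -EFinM.
have := beck h (fun=> powR_ge0 _ _) domh; rewrite hg hq => /(_ domg) -[|_].
  rewrite fin_numM// ge0_fin_numE//; exact: le_lt_trans ED (ltry _).
have pq0 : (0 <= q / (q - 1) / 2)%R by rewrite !divr_ge0 ?(ltW q0) ?(ltW q10).
move=> /le_trans/(_ (lee_wpmul2l _ ED)); rewrite lee_fin => /(_ pq0).
rewrite -EFinM lee_fin -/(M q) -[(\int[mu]_x h x)%R]/(M (q - 1)%R).
rewrite -/(M q) -/k -/(M (q - 1)%R).
set A := (M (q - 1) `^ _)%R => MD.
(* The lower bound on [alpha] can be inserted only in front of a nonnegative difference; a
   nonpositive one leaves nothing to prove beyond the sign of the last term. *)
have [MA|MA] := leP (M q - A)%R 0%R.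
  have : (0 <= q / 2 * ((q - 1) `^ s / a) * k * M q `^ ((q - 2) / q))%R.
    by rewrite !mulr_ge0 ?powR_ge0 ?invr_ge0 ?(ltW q0) ?(ltW a0).
  by rewrite subr_le0 in MA; move=> H; rewrite (le_trans MA)// lerDl.
have ps : ((q / (q - 1) - 1) `^ s = ((q - 1) `^ s)^-1)%R.
  rewrite (_ : q / (q - 1) - 1 = (q - 1)^-1)%R; last by field; rewrite gt_eqF.
  by rewrite -(powR_inv1 (ltW q10)) -powRrM mulN1r powRN.
rewrite ps in aalpha.
have {MD}MD := le_trans (ler_wpM2r (ltW MA) aalpha) MD.
rewrite -lerBlDl.
have qs0 : (0 < (q - 1) `^ s)%R by rewrite powR_gt0.
rewrite -(ler_pM2l (divr_gt0 a0 qs0)) (le_trans MD)//.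
rewrite le_eqVlt; apply/orP; left; apply/eqP; rewrite /D; field.
by rewrite !gt_eqF.
Qed.

End clipped_moments.

(** * The upper deviation, by letting the clipping level grow *)

Section upper_deviation.
Context (d : measure_display) (X : measurableType d) (R : realType).
Variables (mu : probability X R) (Q : R.-ker X ~> X) (a s : R) (alpha : R -> R).
Hypothesis balance : detailed_balance mu Q.
Hypothesis a0 : (0 < a)%R.
Hypothesis s0 : (0 <= s)%R.
Hypothesis beck : forall p : R, (1 < p <= 2)%R ->
  beckner mu Q p (alpha p) /\ (a * (p - 1) `^ s <= alpha p)%R.
Variables (f : X -> R) (r : R).
Hypothesis mf : measurable_fun [set: X] f.
Hypothesis r2 : (2 <= r)%R.
Hypothesis Gfin : 'N[mu]_(r / 2)%:E[Gamma_plus Q f] \is a fin_num.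

Let k : R := fine 'N[mu]_(r / 2)%:E[Gamma_plus Q f].
Let m : R := (\int[mu]_z f z)%R.
Let C (q : R) : R := ((1 - 2 `^ (- (s + 1))) * (q `^ (s + 1) / a) * kappa s)%R.

Let kE : k%:E = 'N[mu]_(r / 2)%:E[Gamma_plus Q f].
Proof. by rewrite /k fineK. Qed.

Let k0 : (0 <= k)%R.
Proof. by rewrite fine_ge0// Lnorm_ge0. Qed.

Let beck2 : beckner mu Q 2 (alpha 2).
Proof. by apply: (beck _).1; rewrite ltr1n lexx. Qed.

Let Gk : \int[mu]_x Gamma_plus Q f x <= k%:E.
Proof. by rewrite kE; exact: integral_Gamma_plus_le. Qed.

Lemma beckner_integrable : mu.-integrable [set: X] (EFin \o f).
Proof. by have [] := beckner_integrable_sqr balance mf beck2 Gk. Qed.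

(** The variance bound controls order 2, and lower orders follow as norms increase with the
    order. *)
Let clip_moment_small (n q : R) : (0 <= n)%R -> (1 <= q <= 2)%R ->
  (\int[mu]_x (clip m n (f x) `^ q) <= (k / a) `^ (q / 2))%R.
Proof.
move=> n0 /andP[q1 q2]; have q0 : (0 < q)%R by lra.
pose g x : R := clip m n (f x).
have g0 x : (0 <= g x)%R by exact: clip_ge0.
have mg : measurable_fun [set: X] g by exact: measurable_clip.
pose M t : R := (\int[mu]_x (g x `^ t))%R.
have ME t : (0 <= t)%R -> \int[mu]_x (g x `^ t)%:E = (M t)%:E.
  move=> t0; rewrite integrable_EFin_Rintegral//.
  exact: integrable_clip_powR.
have M0 t : (0 <= M t)%R by apply: Rintegral_ge0 => x _; exact: powR_ge0.
have M2 : (M 2 <= k / a)%R.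
  have a2 : (0 < a <= alpha 2)%R.
    have two12 : ((1 < 2 :> R) && (2 <= 2 :> R))%R by rewrite ltr1n/=.
    rewrite a0/=; have [_] := beck two12.
    by rewrite (_ : 2 - 1 = 1)%R ?powR1 ?mulr1//; ring.
  rewrite -lee_fin -ME//.
  apply: le_trans (beckner_variance balance mf beck2 a2 Gk).
  apply: ge0_le_integral => //.
  - by move=> x _; rewrite lee_fin powR_ge0.
  - exact/measurable_EFinP/measurable_powR_comp.
  - apply/measurable_EFinP/measurable_funX/measurable_maxr => //.
    exact: measurable_funB.
  move=> x _; rewrite lee_fin powR_mulrn// lerXn2r ?nnegrE//.
    by rewrite le_max lexx orbT.
  by rewrite /g /clip ge_min lexx.
have := poweR_integral_le mu mg g0 q0 q2.
rewrite !ME// ?(ltW q0)// !poweR_EFin lee_fin => Mq2.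
rewrite -/(M q).
have -> : M q = ((M q) `^ q^-1 `^ q)%R.
  by rewrite -powRrM mulVf ?powRr1// gt_eqF.
apply: (@le_trans _ _ ((M 2 `^ 2^-1) `^ q)%R).
  by rewrite ge0_ler_powR ?nnegrE ?powR_ge0 ?(ltW q0).
by rewrite -powRrM mulrC ge0_ler_powR ?nnegrE ?divr_ge0 ?(ltW q0) ?(ltW a0).
Qed.

Let clip_moment (n : R) : (0 <= n)%R ->
  (\int[mu]_x (clip m n (f x) `^ r) <= (C r * k) `^ (r / 2))%R.
Proof.
move=> n0.
apply: (@moment_recursion _
  (fun t => \int[mu]_x (clip m n (f x) `^ t))%R a s k r).
- exact: a0.
- exact: s0.
- exact: k0.
- by move=> q; apply: Rintegral_ge0 => x _; exact: powR_ge0.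
- by move=> q; exact: clip_moment_small.
- move=> q /[dup] qr /andP[q2 _].
  have q10 : (0 < q - 1)%R by lra.
  have p12 : (1 < q / (q - 1) <= 2)%R.
    by rewrite ltr_pdivlMr// ler_pdivrMr//; apply/andP; split; lra.
  have [bp ap] := beck p12.
  exact: beckner_clip_moment bp a0 ap qr n0.
- by rewrite lexx andbT (le_trans _ r2)// ler1n.
Qed.

(** The bound on clipped moments is uniform in the level. At each point the clipped values increase
    and are eventually constant, so monotone convergence applies. *)
Let moment :
  \int[mu]_x (Num.max (f x - m) 0 `^ r)%:E <= ((C r * k) `^ (r / 2))%:E.
Proof.
have r0 : (0 <= r)%R by rewrite (le_trans _ r2).
pose u n x : \bar R := (clip m n%:R (f x) `^ r)%:E.
have mu_ n : measurable_fun [set: X] (u n).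
  by apply/measurable_EFinP/measurable_powR_comp; exact: measurable_clip.
have u0 n x : [set: X] x -> 0 <= u n x by rewrite lee_fin powR_ge0.
have ndu x : [set: X] x -> nondecreasing_seq (u ^~ x).
  move=> _ i j ij; rewrite lee_fin ge0_ler_powR ?nnegrE ?clip_ge0//.
  by rewrite /clip le_min2// ler_nat.
have := @cvg_monotone_convergence _ _ _ mu setT measurableT u mu_ u0 ndu.
have -> : (fun x => limn (u ^~ x)) = (fun x => (Num.max (f x - m) 0 `^ r)%:E).
  apply/funext => x; apply/cvg_lim => //.
  apply: cvg_near_cst; near=> n; rewrite /u /clip min_l//.
  near: n; exact: nbhs_infty_ger.
move=> ucvg; rewrite -(cvg_lim _ ucvg)//; apply: lime_le.
  by apply/cvg_ex; eexists; exact: ucvg.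
apply: nearW => n; rewrite integrable_EFin_Rintegral ?lee_fin.
  exact: clip_moment.
exact: integrable_clip_powR.
Unshelve. all: by end_near. Qed.

Lemma beckner_upper_deviation :
  'N[mu]_(r%:E)[(fun x => (Num.max (f x - m) 0)%R%:E)] ^+ 2 <= (C r)%:E * k%:E.
Proof.
have r0 : (0 < r)%R by rewrite (lt_le_trans _ r2).
have C0 : (0 < C r)%R by exact: deviation_constant_gt0.
have Ck0 : (0 <= C r * k)%R by rewrite mulr_ge0// ltW.
have max0 x : (0 <= Num.max (f x - m) 0)%R by rewrite le_max lexx orbT.
rewrite (ge0_Lnorm mu r max0).
have key (I : \bar R) : 0 <= I -> I <= ((C r * k) `^ (r / 2))%:E ->
    I `^ r^-1 ^+ 2 <= (C r)%:E * k%:E.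
  case: I => [i| |]//; rewrite !lee_fin => i0 iCk.
  rewrite -expr2.
  have -> : (C r * k = ((C r * k) `^ (r / 2) `^ r^-1) ^+ 2)%R.
    rewrite -powRrM -powR_mulrn ?powR_ge0// -powRrM.
    by rewrite (_ : r / 2 / r * 2 = 1)%R ?powRr1//; field; rewrite gt_eqF.
  rewrite lerXn2r ?nnegrE ?powR_ge0//.
  by rewrite ge0_ler_powR ?nnegrE ?powR_ge0 ?invr_ge0 ?(ltW r0).
by apply: key moment; apply: integral_ge0 => x _; rewrite lee_fin powR_ge0.
Qed.

End upper_deviation.

(** * The estimate for a finite right-hand side *)

Section deviation_estimate.
Context (d : measure_display) (X : measurableType d) (R : realType).
Variables (mu : probability X R) (Q : R.-ker X ~> X) (a s : R) (alpha : R -> R).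
Hypothesis balance : detailed_balance mu Q.
Hypothesis a0 : (0 < a)%R.
Hypothesis s0 : (0 <= s)%R.
Hypothesis beck : forall p : R, (1 < p <= 2)%R ->
  beckner mu Q p (alpha p) /\ (a * (p - 1) `^ s <= alpha p)%R.

Lemma upper_deviation_estimate (f : X -> R) (r : R) :
  measurable_fun [set: X] f -> (2 <= r)%R ->
  estimate (mu.-integrable [set: X] (EFin \o f))
    ('N[mu]_(r%:E)[(fun x => (Num.max (f x - \int[mu]_z f z) 0)%R%:E)] ^+ 2)
    (((1 - 2 `^ (- (s + 1))) * (r `^ (s + 1) / a) * kappa s)%R%:E *
       'N[mu]_((r / 2)%R%:E)[Gamma_plus Q f]).
Proof.
move=> mf r2; have r0 : (0 < r)%R by rewrite (lt_le_trans _ r2).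
have C0 := deviation_constant_gt0 a0 s0 r0.
move=> Bfin.
(* A positive constant times [+oo] is [+oo], so a finite product forces a finite norm. *)
have Gfin : 'N[mu]_(r / 2)%:E[Gamma_plus Q f] \is a fin_num.
  rewrite ge0_fin_numE ?Lnorm_ge0// ltey; apply/eqP => Goo.
  by move: Bfin; rewrite Goo gt0_muley// lte_fin.
split; first exact: (beckner_integrable balance beck mf r2 Gfin).
have := beckner_upper_deviation balance a0 s0 beck mf r2 Gfin.
by rewrite fineK.
Qed.

End deviation_estimate.

Theorem proposition3p1 (d : measure_display) (X : measurableType d)
    (R : realType) (mu : probability X R) (Q : R.-ker X ~> X)
    (a s : R) (alpha : R -> R) :
  detailed_balance mu Q ->
  (0 < a)%R -> (0 <= s)%R ->
  (forall p : R, (1 < p <= 2)%R ->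
     beckner mu Q p (alpha p) /\ (a * (p - 1) `^ s <= alpha p)%R) ->
  forall (f : X -> R) (r : R), measurable_fun [set: X] f -> (2 <= r)%R ->
    estimate (mu.-integrable [set: X] (EFin \o f))
      ('N[mu]_(r%:E)[(fun x => (Num.max (f x - \int[mu]_z f z) 0)%R%:E)] ^+ 2)
      (((1 - 2 `^ (- (s + 1))) * (r `^ (s + 1) / a) * kappa s)%R%:E *
         'N[mu]_((r / 2)%R%:E)[Gamma_plus Q f]) /\
    estimate (mu.-integrable [set: X] (EFin \o f))
      ('N[mu]_(r%:E)[(fun x => (Num.max (\int[mu]_z f z - f x) 0)%R%:E)] ^+ 2)
      (((1 - 2 `^ (- (s + 1))) * (r `^ (s + 1) / a) * kappa s)%R%:E *
         'N[mu]_((r / 2)%R%:E)[Gamma_plus Q (fun x => - f x)%R]).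
Proof.
move=> balance a0 s0 beck f r mf r2.
split; first exact: (upper_deviation_estimate balance a0 s0 beck).
have mNf : measurable_fun [set: X] (fun x => - f x)%R.
  exact: measurableT_comp.
have := upper_deviation_estimate balance a0 s0 beck mNf r2.
rewrite /estimate => H /H[iNf].
(* Integrability is obtained first, since it is used to rewrite the mean of [- f] as minus the mean
   of [f]. *)
have ifN : mu.-integrable [set: X] (EFin \o f).
  have := integrable_EFinZ (- 1)%R iNf.
  by apply: eq_integrable => // x _ /=; rewrite mulN1r opprK.
have -> : (\int[mu]_z (- f z) = - \int[mu]_z f z)%R.
  under eq_Rintegral do rewrite -mulN1r.
  by rewrite RintegralZl// mulN1r.
have -> : (fun x => (Num.max (- f x - - \int[mu]_z f z) 0)%R%:E) =
    (fun x => (Num.max (\int[mu]_z f z - f x) 0)%R%:E).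
  by apply/funext => x; rewrite opprK addrC.
by split.
Qed.
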